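(* For each real number $\varepsilon > 0$ and each integer $c \ge 1$, there is a simple triangle-free binary matroid $M$ such that $|M| \ge \left(\tfrac{1}{4}-\varepsilon\right)2^{r(M)}$ and $M$ has critical number $c$.
   Context: Matroids are finite. For a matroid $M$, $E(M)$ is its ground set, $|M| = |E(M)|$, and $r(M)$ is its rank. A simple binary matroid of rank $r$ is viewed as a restriction of the projective geometry $G \cong \mathrm{PG}(r-1,2)$ (equivalently, as a set of nonzero vectors in $\mathrm{GF}(2)^r$). The critical number $\chi(M)$ is the minimum nonnegative integer $c$ such that $G$ has a rank-$(r-c)$ flat disjoint from $E(M)$; equivalently, the minimum codimension of a subspace of $\mathrm{GF}(2)^r$ containing no element of $E(M)$. A matroid is triangle-free if it has no restriction isomorphic to $U_{2,3}$ (for a simple binary matroid represented by a set $X$ of nonzero vectors: no three distinct elements of $X$ sum to zero). *)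

(* Defs.v *)
From mathcomp Require Import all_boot all_order all_algebra.
From mathcomp Require Import reals.

Set Implicit Arguments.
Unset Strict Implicit.
Unset Printing Implicit Defensive.

Import GRing.Theory.
Local Open Scope ring_scope.

Definition span_rank (n : nat) (A : {set 'rV['F_2]_n}) : nat :=
  \rank (\sum_(x in A) <<x>>)%MS.

(* The points of PG(r-1, 2) are the nonzero vectors of GF(2)^r.  The last field
   makes [sbm_dim] the rank of the matroid, so that the geometry in which the
   critical number is computed is indeed PG(r(M)-1, 2). *)
Record simple_binary_matroid : Type := SimpleBinaryMatroid {
  sbm_dim : nat;
  ground : {set 'rV['F_2]_sbm_dim};
  ground_nonzero : 0 \notin ground;
  ground_spans : span_rank ground = sbm_dim
}.

Definition matroid_rank (M : simple_binary_matroid) : nat :=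
  span_rank (ground M).

(* The restriction of M to T is isomorphic to U_{2,3}: the latter is the matroid
   on three elements whose rank function is A |-> min(|A|, 2). *)
Definition is_triangle (M : simple_binary_matroid)
    (T : {set 'rV['F_2]_(sbm_dim M)}) : Prop :=
  [/\ T \subset ground M, #|T| = 3%N
    & forall A : {set 'rV['F_2]_(sbm_dim M)},
        A \subset T -> span_rank A = minn #|A| 2].

Definition triangle_free (M : simple_binary_matroid) : Prop :=
  forall T : {set 'rV['F_2]_(sbm_dim M)}, ~ is_triangle T.

(* Flats are the row spaces of square matrices U.  The equation
   rank U + c = r(M) forces c <= r(M), hence avoids truncated subtraction. *)
Definition has_disjoint_flat (M : simple_binary_matroid) (c : nat) : bool :=
  [exists U : 'M['F_2]_(sbm_dim M),
     (\rank U + c == matroid_rank M)%N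
     && [forall x in ground M, ~~ (x <= U)%MS]].

Lemma ex_disjoint_flat (M : simple_binary_matroid) :
  exists c, has_disjoint_flat M c.
Proof.
exists (matroid_rank M); apply/existsP; exists 0.
rewrite mxrank0 add0n eqxx /=; apply/forall_inP => x xM.
by rewrite submx0; apply: contraNneq (ground_nonzero M) => <-.
Qed.

Definition critical_number (M : simple_binary_matroid) : nat :=
  ex_minn (ex_disjoint_flat M).

(* Main.v *)
(** Points of GF(2)^(n+1) are written (e, x) with e in GF(2) and x in GF(2)^n,
    where n = 2t + k and t is large. Take the points (1, x) with |x| <= t and
    the points (0, x) with |x| > 2t. Two points of the first kind sum to a
    vector of weight at most 2t, and three vectors of weight more than 2t cannot
    sum to zero when 3(2t + 1) > 2n; hence there is no triangle. The first kind
    alone has almost 2^n / 2 elements, since only the k middle layers of the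
    cube are lost. The critical number is k + 1: a subspace of dimension d has
    d coordinates on which its elements take arbitrary values. If the subspace
    lies in e = 0 and has codimension at most k, setting these to 1 yields a
    vector of weight more than 2t; otherwise, setting them to 0 inside the
    coset e = 1 yields a vector of weight at most k <= t. *)
Require Import Defs.
From mathcomp Require Import all_boot all_order all_algebra.
From mathcomp Require Import reals.
From mathcomp Require Import zify lra.
Local Open Scope ring_scope.

Set Implicit Arguments.
Unset Strict Implicit.
Unset Printing Implicit Defensive.

Import Order.TTheory GRing.Theory Num.Theory.

(** * Binomial estimates and the layers of the cube *)

Lemma mul_central_bin n :
  (n.+1 * 'C(n.+1 + n.+1, n.+1) = 2 * ((n + n).+1 * 'C(n + n, n)))%N.
Proof.
have h1 := mul_bin_diag (n.+1 + n.+1) n.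
have h2 := mul_bin_down (n + n).+1 n.
rewrite /= !addnS !addSn /= in h1 h2 *.
have e : ((n + n).+1 - n = n.+1)%N by lia.
rewrite e in h2; rewrite h2 -h1; lia.
Qed.

Lemma central_bin_bound n : ('C(n + n, n) ^ 2 * (n + n).+1 <= 16 ^ n)%N.
Proof.
elim: n => [|n IHn]; first by rewrite bin0.
have e := mul_central_bin n.
move: e; set C' := 'C(n.+1 + n.+1, n.+1); move: IHn; set C := 'C(n + n, n).
move=> IHn e.
have p : (0 < n.+1 ^ 2)%N by rewrite expn_gt0.
rewrite -(leq_pmul2l p) mulnA -expnMn e !expnMn (expnS 16).
have q : (((n + n).+1 ^ 2 * C ^ 2) * (n.+1 + n.+1).+1
          = (C ^ 2 * (n + n).+1) * ((n + n).+1 * (n.+1 + n.+1).+1))%N.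
  by rewrite !mulnA; lia.
rewrite -mulnA q.
(* The left side is 4(n+1)^2 - 1, since 2n+1 and 2n+3 lie symmetrically about 2(n+1). *)
have le2 : ((n + n).+1 * (n.+1 + n.+1).+1 <= 4 * n.+1 ^ 2)%N by nia.
have := leq_mul IHn le2; lia.
Qed.

(** By Vandermonde, ['C(n, j) ^ 2] is one term of a sum equal to ['C(n + n, n)]. Hence each layer is
    a vanishing fraction of the cube, uniformly in [j]; fourth powers keep the estimate free of
    roots. *)
Lemma bin_fourth_power_bound n j : ('C(n, j) ^ 4 * (n + n).+1 <= 16 ^ n)%N.
Proof.
apply: leq_trans (central_bin_bound n); rewrite leq_mul2r; apply/orP; right.
have [le_jn|lt_nj] := leqP j n; last by rewrite bin_small.
rewrite (expnM _ 2 2) leq_exp2r // -(binomial.Vandermonde n n n).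
have jP : (j < n.+1)%N by [].
rewrite (bigD1 (Ordinal jP)) //= bin_sub // -mulnn; exact: leq_addr.
Qed.

(** Complementation maps the sets of size at most [t] onto those of size at least [t + k], so these
    two families and the layers [t + 1] to [t + k] cover the cube. The overlap at [t + k] is
    harmless for an upper bound. *)
Lemma card_small_sets n t k : n = (t + t + k)%N ->
  (2 ^ n <= 2 * #|[set A : {set 'I_n} | #|A| <= t]|
            + \sum_(i < k) 'C(n, t + i.+1))%N.
Proof.
move=> nE; set S := [set A | _].
pose L (i : 'I_k) := [set A : {set 'I_n} | #|A| == (t + i.+1)%N].
have cL i : #|L i| = 'C(n, t + i.+1) by rewrite card_draws card_ord.
have cT : #|[set: {set 'I_n}]| = (2 ^ n)%N.
  by rewrite -powersetT card_powerset cardsT card_ord.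
have cSC : #|[set ~: A | A in S]| = #|S| by rewrite card_imset //; exact: setC_inj.
have sub : [set: {set 'I_n}] \subset
    S :|: ([set ~: A | A in S] :|: \bigcup_(i : 'I_k) L i).
  apply/subsetP => A _; rewrite !inE.
  have cA := cardsC A; rewrite card_ord in cA.
  have [//|lt_tA] := leqP #|A| t => /=.
  have [leC|ltC] := leqP #|~: A| t.
    apply/orP; left; apply/imsetP; exists (~: A); first by rewrite inE.
    by rewrite setCK.
  apply/orP; right.
  have iP : (#|A| - t.+1 < k)%N by lia.
  apply/bigcupP; exists (Ordinal iP) => //.
  by rewrite inE /= addnS -addSn subnKC.
rewrite -cT; apply: leq_trans (subset_leq_card sub) _.
rewrite mul2n -addnn -addnA.
apply: leq_trans (leq_card_setU _ _) _; rewrite leq_add2l.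
apply: leq_trans (leq_card_setU _ _) _; rewrite cSC leq_add2l.
under [X in (_ <= X)%N]eq_bigr => i _ do rewrite -cL.
elim/big_rec2: _ => [|i x X _ IH]; first by rewrite cards0.
by apply: leq_trans (leq_card_setU _ _) _; rewrite leq_add2l.
Qed.

(** * Vectors over GF(2) and information sets *)

Lemma F2_eq1 (a : 'F_2) : a != 0 -> a = 1.
Proof. by case: a => [[|[|]]] //= *; apply: val_inj. Qed.

Lemma F2_addxx n (x : 'rV['F_2]_n) : x + x = 0.
Proof. by apply/rowP => i; rewrite !mxE; case: (x 0 i) => [[|[|]]] //= *; apply: val_inj. Qed.

(* The columns of [S] form an information set of the code spanned by [U]. *)
Lemma information_set (F : fieldType) m n (U : 'M[F]_(m, n)) :
  exists2 S : {set 'I_n}, #|S| = \rank U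
    & forall f : 'rV[F]_n, exists2 x : 'rV[F]_n, (x <= U)%MS
      & {in S, forall i, x 0 i = f 0 i}.
Proof.
have [g [g_inj g_free]] : exists g : 'I_(\rank U) -> 'I_n,
    injective g /\ row_free (rowsub g U^T).
  rewrite -(mxrank_tr U).
  exists (maxrankfun U^T); split; first exact: maxrankfun_inj.
  exact: maxrowsub_free.
exists [set g i | i in 'I_(\rank U)]; first by rewrite card_imset // card_ord.
move=> f.
have fullg : row_full (colsub g U).
  by rewrite /row_full -mxrank_tr trmx_mxsub; exact: g_free.
have /submxP[y yE] : (colsub g f <= colsub g U)%MS by apply: submx_full.
exists (y *m U); first exact: submxMl.
move=> _ /imsetP[j _ ->].
by have /matrixP/(_ 0 j) := yE; rewrite mulmx_colsub !mxE => ->.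
Qed.

Lemma subset_setC_card n (A B : {set 'I_n}) : A \subset ~: B -> (#|A| <= n - #|B|)%N.
Proof. by move=> /subset_leq_card; rewrite [#|~: B|]cardsCs setCK card_ord. Qed.

(** * The two-level point set; coordinate [ord0] plays the part of e *)

Section Ground.

Variable n : nat.
Implicit Types x y z : 'rV['F_2]_n.+1.

Definition tail_support x : {set 'I_n} := [set i | x 0 (lift ord0 i) != 0].

Definition two_level_ground t : {set 'rV['F_2]_n.+1} :=
  [set x : 'rV['F_2]_n.+1 | if x 0 ord0 == 0 then (t + t < #|tail_support x|)%N
           else (#|tail_support x| <= t)%N].

Lemma two_level_ground_nonzero t : 0 \notin two_level_ground t.
Proof.
rewrite inE mxE eqxx -leqNgt; apply: leq_trans (_ : 0 <= _)%N => //.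
by rewrite leqn0 cards_eq0; apply/eqP/setP => i; rewrite !inE mxE eqxx.
Qed.

Lemma card_tail_supportD x y :
  (#|tail_support (x + y)| <= #|tail_support x| + #|tail_support y|)%N.
Proof.
apply: leq_trans (leq_card_setU _ _); apply: subset_leq_card.
apply/subsetP => i; rewrite !inE mxE; apply: contraR.
by rewrite negb_or !negbK => /andP[/eqP-> /eqP->]; rewrite addr0.
Qed.

(** Double counting: since 1 + 1 = 0, each coordinate is nonzero in at most two of [x], [y] and
    [x + y]. *)
Lemma card_tail_support3 x y :
  (#|tail_support x| + #|tail_support y| + #|tail_support (x + y)| <= n + n)%N.
Proof.
have sub : tail_support (x + y) \subset ~: (tail_support x :&: tail_support y).
  apply/subsetP => i; rewrite !inE mxE; apply: contraL => /andP[/F2_eq1-> /F2_eq1->].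
  by rewrite negbK; apply/eqP; apply: val_inj.
have := subset_leq_card sub.
have := cardsC (tail_support x :&: tail_support y); rewrite card_ord.
have := cardsUI (tail_support x) (tail_support y).
have := max_card (tail_support x :|: tail_support y); rewrite card_ord.
lia.
Qed.

Lemma two_level_ground_sum_free t x y : (n + n < 3 * (t + t).+1)%N ->
  x \in two_level_ground t -> y \in two_level_ground t ->
  x + y \notin two_level_ground t.
Proof.
move=> n_lt; rewrite !inE mxE.
have e11 : 1 + 1 = 0 :> 'F_2 by apply: val_inj.
have e10 : 1 != 0 :> 'F_2 by exact: oner_neq0.
have s1 := card_tail_supportD x y.
(* In characteristic 2 each of [x], [y], [x + y] is the sum of the other two. So if exactly two of
   them have e = 1, the third has weight at most [t + t], whichever it is; [s4] settles the case of
   none. *)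
have s2 := card_tail_supportD x (x + y); rewrite addrA F2_addxx add0r in s2.
have s3 := card_tail_supportD (x + y) y; rewrite -addrA F2_addxx addr0 in s3.
have s4 := card_tail_support3 x y.
case: (eqVneq (x 0 ord0) 0) => [->|/F2_eq1->];
  case: (eqVneq (y 0 ord0) 0) => [->|/F2_eq1->];
  rewrite ?addr0 ?add0r ?e11 ?eqxx ?(negbTE e10); lia.
Qed.

(** The points (1, 0) and (1, e_j) have tail weight at most 1, hence belong to the set once [t] is
    positive, and their differences give the remaining unit vectors. *)
Lemma two_level_ground_spans t : (0 < t)%N ->
  span_rank (two_level_ground t) = n.+1.
Proof.
move=> t_gt0; rewrite /span_rank; set V := (\sum_(x in _) _)%MS.
apply/eqP; rewrite -[_ == _]/(row_full V) -sub1mx; apply/row_subP => i.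
have gV x : x \in two_level_ground t -> (x <= V)%MS.
  by move=> xG; apply: (sumsmx_sup x) => //; rewrite genmxE.
have e0 : delta_mx 0 ord0 \in two_level_ground t.
  rewrite inE mxE !eqxx /= (_ : tail_support _ = set0) ?cards0 //.
  by apply/setP => j; rewrite !inE mxE /=.
rewrite rowE mulmx1.
case: (unliftP ord0 i) => [j ->|->]; last exact: gV.
rewrite -[delta_mx _ _](addKr (delta_mx 0 ord0)).
apply: addmx_sub; first by rewrite (eqmx_opp _) gV.
apply: gV; rewrite inE !mxE !eqxx /=.
rewrite (_ : tail_support _ = [set j]) ?cards1 //.
apply/setP => l; rewrite !inE !mxE (inj_eq lift_inj) /= add0r.
by case: (l == j); rewrite ?eqxx ?oner_eq0.
Qed.

Lemma two_level_ground_meets_large_subspace t k (U : 'M['F_2]_n.+1) :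
  n = (t + t + k)%N -> (k <= t)%N -> (n.+1 <= \rank U + k)%N ->
  exists2 x, x \in two_level_ground t & (x <= U)%MS.
Proof.
move=> nE le_kt rU.
(* If e vanishes on [W], prescribing the value 1 shows that [ord0] is in no information set, so the
   whole of [S] lies among the tail coordinates. *)
have infoset0 (W : 'M['F_2]_n.+1) (S : {set 'I_n.+1}) :
    (forall x, (x <= W)%MS -> x 0 ord0 = 0) ->
    (forall f : 'rV_n.+1, exists2 x : 'rV_n.+1, (x <= W)%MS
      & {in S, forall i, x 0 i = f 0 i}) ->
    #|[set i : 'I_n | lift ord0 i \in S]| = #|S|.
  move=> W0 WS; rewrite -(card_imset _ (@lift_inj _ ord0)).
  apply/eq_card => i; apply/imsetP/idP => [[j]|iS]; first by rewrite inE => jS ->.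
  case: (unliftP ord0 i) iS => [j -> jS|-> oS]; first by exists j => //; rewrite inE.
  have [x /W0 x0 /(_ _ oS)] := WS (const_mx 1); rewrite x0 mxE => /eqP.
  by rewrite eq_sym oner_eq0.
case: (pickP (fun x => (x <= U)%MS && (x 0 ord0 != 0))) => [v|noU].
  case/andP=> vU v0.
  (* [W] is the part of [U] in the hyperplane e = 0; adding its elements to [v] stays in [U] and
     keeps e = 1. *)
  pose W := (U :&: kermx (delta_mx ord0 0 : 'cV['F_2]_n.+1))%MS.
  have rW : (\rank U <= (\rank W).+1)%N.
    have := mxrank_mul_ker U (delta_mx ord0 0 : 'cV['F_2]_n.+1); rewrite -/W.
    by move=> <-; exact: leq_add (rank_leq_col _) (leqnn _).
  have W0 x : (x <= W)%MS -> x 0 ord0 = 0.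
    rewrite sub_capmx => /andP[_ /sub_kermxP].
    by rewrite -colE => /matrixP/(_ 0 0); rewrite !mxE.
  have [S cS WS] := information_set W.
  have cS' := infoset0 _ _ W0 WS.
  rewrite -cS -cS' in rW.
  have rS := leq_trans rU (leq_add rW (leqnn k)).
  have [w wW wS] := WS v.
  exists (v + w); last first.
    by apply: addmx_sub => //; move: wW; rewrite sub_capmx => /andP[].
  rewrite inE mxE (W0 _ wW) addr0 (negbTE v0).
  have sub : tail_support (v + w) \subset ~: [set i | lift ord0 i \in S].
    apply/subsetP => i; rewrite !inE mxE; apply: contra => /wS ->.
    by have /rowP/(_ (lift ord0 i)) := F2_addxx v; rewrite !mxE => ->.
  apply: leq_trans (subset_setC_card sub) _; rewrite leq_subLR.
  (* The dimension lost in passing from [U] to [W] is balanced by the coordinate e: the successors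
     on both sides of [rS] cancel by conversion. *)
  by apply: (leq_trans (rS : n <= _ + k)%N); rewrite leq_add2l.
have U0 x : (x <= U)%MS -> x 0 ord0 = 0.
  by move=> xU; have := noU x; rewrite xU => /negbFE/eqP.
have [S cS US] := information_set U.
have cS' := infoset0 _ _ U0 US.
rewrite -cS -cS' in rU.
have [x xU xS] := US (const_mx 1).
exists x => //; rewrite inE (U0 _ xU) eqxx.
have sub : [set i | lift ord0 i \in S] \subset tail_support x.
  by apply/subsetP => i; rewrite !inE => /xS ->; rewrite mxE oner_eq0.
apply: leq_trans (subset_leq_card sub).
by rewrite -(leq_add2r k) addSn -nE.
Qed.

(** The row space of [copid_mx k.+1] consists of the vectors whose first k+1 coordinates vanish: e
    and k tail coordinates. The other tail coordinates number only [t + t], too few for a point with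
    e = 0. *)
Lemma two_level_ground_avoids_flat t k x : n = (t + t + k)%N ->
  x \in two_level_ground t -> ~~ (x <= copid_mx k.+1)%MS.
Proof.
move=> nE xG; apply/negP => /submxP[y yE].
have x0 (i : 'I_n.+1) : (i < k.+1)%N -> x 0 i = 0.
  move=> ik; rewrite yE /copid_mx mulmxBr mulmx1 !mxE.
  rewrite (bigD1 i) //= big1 => [|j ji]; rewrite mxE.
    by rewrite eqxx ik mulr1 addr0 subrr.
  by rewrite (_ : (j == i :> nat) = false) ?mulr0 //; apply/negbTE.
move: xG; rewrite inE x0 // eqxx ltnNge => /negP; apply.
have kn : (k <= n)%N by lia.
have sub : tail_support x \subset ~: [set widen_ord kn i | i in 'I_k].
  apply/subsetP => i; rewrite !inE; apply: contra => /imsetP[j _ ->].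
  by apply/eqP/x0; rewrite lift0 /= ltnS.
apply: leq_trans (subset_setC_card sub) _.
rewrite card_imset ?card_ord; first by rewrite nE addnK.
by move=> i j /(congr1 val) /= /val_inj.
Qed.

(** The points with e = 1 already suffice: [A] is sent to (1, indicator of [A]). *)
Lemma card_two_level_ground t :
  (#|[set A : {set 'I_n} | #|A| <= t]| <= #|two_level_ground t|)%N.
Proof.
pose f (A : {set 'I_n}) : 'rV['F_2]_n.+1 :=
  \row_i if unlift ord0 i is Some j then (j \in A)%:R else 1.
have fK : cancel f tail_support.
  move=> A; apply/setP => i; rewrite inE mxE liftK.
  by case: (i \in A); rewrite ?oner_eq0 ?eqxx.
rewrite -(card_imset _ (can_inj fK)); apply: subset_leq_card.
apply/subsetP => x /imsetP[A]; rewrite inE => At ->.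
by rewrite inE mxE unlift_none oner_eq0 fK.
Qed.

End Ground.

(** * Triangles and the critical number of the matroid *)

Definition two_level_matroid n t (t_gt0 : (0 < t)%N) : simple_binary_matroid :=
  SimpleBinaryMatroid (two_level_ground_nonzero n t) (two_level_ground_spans n t_gt0).

(** The rank condition puts one element x of the triangle in the span of the other two, so x = ay +
    bz. As x is nonzero and differs from y and z, only a = b = 1 remains. *)
Lemma triangle_sum (M : simple_binary_matroid) (T : {set 'rV['F_2]_(sbm_dim M)}) :
  is_triangle T ->
  exists x y, [/\ x \in ground M, y \in ground M & x + y \in ground M].
Proof.
case=> TM T3 rT.
have [x xT] : exists x, x \in T by apply/card_gt0P; rewrite T3.
have c2 : #|T :\ x| = 2%N by have := cardsD1 x T; rewrite xT T3; lia.
have [y [z [yT zT yz TE]]] : exists y z, [/\ y \in T, z \in T, y != z & T :\ x = [set y; z]].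
  case/eqP/cards2P: c2 => y [z [yz TE]].
  have sub : T :\ x \subset T by apply: subD1set.
  by exists y, z; split=> //; apply: (subsetP sub); rewrite TE !inE eqxx ?orbT.
have xnz : x \notin [set y; z] by rewrite -TE !inE eqxx.
exists y, z; split; try exact: (subsetP TM).
have rYZ : span_rank [set y; z] = 2%N by rewrite rT ?cards2 ?yz // -TE subD1set.
have rT2 : span_rank T = 2%N by rewrite rT // T3.
have yzT : (\sum_(u in [set y; z]) <<u>> <= \sum_(u in T) <<u>>)%MS.
  apply/sumsmx_subP => u; rewrite -TE => /setD1P[_ uT].
  by apply: (sumsmx_sup u).
have eqS : (\sum_(u in [set y; z]) <<u>> == \sum_(u in T) <<u>>)%MS.
  by rewrite -(mxrank_leqif_eq yzT) -!/(span_rank _) rYZ rT2.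
have : (x <= \sum_(u in [set y; z]) <<u>>)%MS.
  by rewrite (eqmxP eqS); apply: (sumsmx_sup x) => //; rewrite genmxE.
rewrite big_setU1 ?inE // big_set1 /=.
case/sub_addsmxP => -[u v] /= xE.
have xG : x \in ground M by apply: (subsetP TM).
have /sub_rVP[a aE] : (u *m <<y>> <= y)%MS.
  by apply: submx_trans (submxMl _ _) _; rewrite genmxE.
have /sub_rVP[b bE] : (v *m <<z>> <= z)%MS.
  by apply: submx_trans (submxMl _ _) _; rewrite genmxE.
move: xG xnz (ground_nonzero M); rewrite xE aE bE.
case: (eqVneq a 0) => [->|/F2_eq1->]; case: (eqVneq b 0) => [->|/F2_eq1->];
  rewrite ?scale0r ?scale1r ?addr0 ?add0r ?inE ?eqxx ?orbT //.
by move=> ->.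
Qed.

Lemma two_level_triangle_free n t (t_gt0 : (0 < t)%N) :
  (n + n < 3 * (t + t).+1)%N -> triangle_free (two_level_matroid n t_gt0).
Proof.
move=> nt T /triangle_sum[x [y [xG yG]]].
by apply/negP/two_level_ground_sum_free.
Qed.

Lemma two_level_critical_number t k (t_gt0 : (0 < t)%N) : (k <= t)%N ->
  critical_number (two_level_matroid (t + t + k) t_gt0) = k.+1.
Proof.
move=> le_kt; rewrite /critical_number; case: ex_minnP => m /existsP[U].
have rE : matroid_rank (two_level_matroid (t + t + k) t_gt0) = (t + t + k).+1.
  exact: two_level_ground_spans.
case/andP; rewrite rE => /eqP rU /forall_inP UG min_m.
apply/eqP; rewrite eqn_leq; apply/andP; split.
  apply: min_m; apply/existsP; exists (copid_mx k.+1).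
  rewrite rE rank_copid_mx /=; last by lia.
  apply/andP; split; first by apply/eqP; lia.
  by apply/forall_inP => x; apply: two_level_ground_avoids_flat.
rewrite ltnNge; apply/negP => le_mk.
have [||//|x xG xU] := @two_level_ground_meets_large_subspace (t + t + k) t k U => //.
  by rewrite /= in rU; lia.
by have := UG x xG; rewrite xU.
Qed.

(** * Density and the choice of parameters *)

Lemma card_small_sets_dense (R : realType) (d : R) n t k :
  n = (t + t + k)%N -> 0 <= d -> k%:R ^+ 4 <= d ^+ 4 * t%:R ->
  (1 - d) * 2 ^+ n <= 2 * #|[set A : {set 'I_n} | (#|A| <= t)%N]|%:R.
Proof.
move=> nE d_ge0 dt.
(* Each of the [k] middle layers is to take at most a fraction [d / k] of the cube; the hypothesis
   on [t] is this requirement raised to the fourth power, with [t] below [(n + n).+1]. *)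
have bin_le j : k%:R * 'C(n, j)%:R <= d * 2 ^+ n :> R.
  rewrite -(@ler_pXn2r _ 4) // ?nnegrE ?mulr_ge0 ?exprn_ge0 //.
  rewrite !exprMn -exprM mulnC exprM.
  have C_ge0 : 0 <= 'C(n, j)%:R ^+ 4 :> R by rewrite exprn_ge0.
  apply: le_trans (ler_wpM2r C_ge0 dt) _.
  rewrite -mulrA ler_wpM2l ?exprn_ge0 //.
  have e : (2 ^+ 4) ^+ n = (16 ^ n)%N%:R :> R.
    by rewrite natrX; congr (_ ^+ n); rewrite -natrX.
  rewrite e -natrX -natrM ler_nat mulnC.
  apply: leq_trans (bin_fourth_power_bound n j).
  by rewrite leq_mul2l; apply/orP; right; lia.
have sum_le : \sum_(i < k) 'C(n, t + i.+1)%:R <= d * 2 ^+ n :> R.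
  case: k {dt nE} bin_le => [|k] bin_le.
    by rewrite big_ord0 mulr_ge0 ?exprn_ge0.
  rewrite -(ler_pM2l (_ : 0 < k.+1%:R)) ?ltr0n // mulr_sumr.
  apply: le_trans (ler_sum _ (fun i _ => bin_le _)) _.
  by rewrite sumr_const card_ord mulr_natl.
have := card_small_sets nE; rewrite -(ler_nat R) natrD natrM natrX natr_sum.
by lra.
Qed.

Theorem theorem1p2 (R : realType) (eps : R) (heps : 0 < eps)
    (c : nat) (hc : (1 <= c)%N) :
  exists M : simple_binary_matroid,
    [/\ triangle_free M,
        (1 / 4 - eps) * 2 ^+ matroid_rank M <= #|ground M|%:R
      & critical_number M = c].
Proof.
case: c hc => // k _.
(* With rank n+1, (1/4 - eps) 2^(n+1) = (1 - 4 eps) 2^n / 2. *)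
pose d : R := 4 * eps.
have d_gt0 : 0 < d by rewrite mulr_gt0.
pose b := Num.bound (k%:R ^+ 4 / d ^+ 4).
(* The summand [b] serves density; [k] and the successor give [k <= t], positivity and 2(2t + k) <
   3(2t + 1). *)
pose t := (k + b).+1.
have t_gt0 : (0 < t)%N by [].
have dt : k%:R ^+ 4 <= d ^+ 4 * t%:R.
  rewrite mulrC -ler_pdivrMr ?exprn_gt0 //.
  apply: le_trans (ltW (archi_boundP _)) _.
    by rewrite divr_ge0 ?exprn_ge0 // ltW.
  by rewrite ler_nat -/b /t; lia.
exists (two_level_matroid (t + t + k) t_gt0); split.
- by apply: two_level_triangle_free; rewrite /t; lia.
- rewrite [matroid_rank _]two_level_ground_spans //=.
  have := card_small_sets_dense erefl (ltW d_gt0) dt.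
  have := card_two_level_ground (t + t + k) t; rewrite -(ler_nat R).
  by rewrite exprS /d; lra.
- by apply: two_level_critical_number; rewrite /t; lia.
Qed.
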